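(* Let $\mathbb{F}=\mathbb{R}$ or $\mathbb{C}$, let $1\le p\le n$, let $A\in\mathbb{F}^{n\times n}$ be an invertible Hermitian matrix, let $\mathcal{T}$ be a $p$-dimensional affine subspace of $\mathbb{F}^n$, and let $\mathcal{S}$ be the $p$-dimensional linear subspace of $\mathbb{F}^n$ parallel to $\mathcal{T}$. Put $\omega_{\min}:=-\lambda_{\min}(A)$ and $q:=\dim(\mathcal{S}+A\mathcal{S})-\dim(\mathcal{S})$. For $b\in\mathbb{F}^n$ and $\omega\in(\omega_{\min},\infty)$ let $$x_{b,\omega}:=\operatorname*{arg\,min}_{x\in\mathcal{T}}\big\|(A+\omega I)^{-1/2}(Ax-b)\big\|_2 .$$ Then there exists a $q$-dimensional linear subspace $\mathcal{Y}$ of $\mathbb{F}^n$, independent of $b$, such that $x_{b,\omega}-x_{b,\mu}\in\mathcal{Y}$ for all $b\in\mathbb{F}^n$ and all $\omega,\mu\in(\omega_{\min},\infty)$. Moreover, when $q\ge1$: if $V\in\mathbb{F}^{n\times p}$ and $V'\in\mathbb{F}^{n\times q}$ are chosen such that $\begin{bmatrix}V&V'\end{bmatrix}$ has orthonormal columns, $\operatorname{Im}(V)=\mathcal{S}$ and $\operatorname{Im}(\begin{bmatrix}V&V'\end{bmatrix})=\mathcal{S}+A\mathcal{S}$, then one may take $\mathcal{Y}=\operatorname{Im}\big(V(H^*H)^{-1}B^*\big)$, where $T=V^*AV$, $B=V'^*AV$ and $H^*=\begin{bmatrix}T&B^*\end{bmatrix}$; this subspace does not depend on the choice of $V,V'$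.
   Context: $\lambda_{\min}(A)\in\mathbb{R}$ is the smallest eigenvalue of the Hermitian matrix $A$. For $\omega>\omega_{\min}$ the matrix $A+\omega I$ is Hermitian positive definite, so its power $-1/2$ is defined through the spectral decomposition (positive roots). The minimizer $x_{b,\omega}$ exists and is unique. The linear subspace parallel to $\mathcal{T}$ is $\{x-y : x,y\in\mathcal{T}\}$. $A\mathcal{S}=\{Ax: x\in\mathcal{S}\}$, $\operatorname{Im}$ denotes the column space, and $M^*$ is the conjugate transpose (transpose if $\mathbb{F}=\mathbb{R}$). *)

(* Defs.v *)
From HB Require Import structures.
From mathcomp Require Import all_boot all_order all_algebra.
From mathcomp Require Import boolp classical_sets reals.
From mathcomp Require Import complex.

Set Implicit Arguments.
Unset Strict Implicit.
Unset Printing Implicit Defensive.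

Import Order.TTheory GRing.Theory Num.Theory.

Local Open Scope classical_set_scope.
Local Open Scope ring_scope.

(* A common signature for the two fields [R] and [R[i]]; it carries no laws
   relating its components, as it is only ever used at the two instances
   below. *)
Record scalars (R : realType) := Scalars {
  scalar :> fieldType;
  of_real : {rmorphism R -> scalar};
  conj : {rmorphism scalar -> scalar};
  modulus : scalar -> R }.

Definition real_scalars (R : realType) : scalars R :=
  @Scalars R R idfun idfun (fun x => `|x|).

Definition complex_scalars (R : realType) : scalars R :=
  @Scalars R R[i] (real_complex R) conjc (@Normc.normc R).

Section Defs.
Variables (R : realType) (K : scalars R).

Definition adjmx m n (M : 'M[K]_(m, n)) : 'M[K]_(n, m) := (map_mx (conj K) M)^T.

Definition norm2 n (v : 'cV[K]_n) : R :=
  Num.sqrt (\sum_i modulus (v i 0) ^+ 2).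

Definition smallest_eigenvalue n (A : 'M[K]_n) (l : R) : Prop :=
  eigenvalue A (of_real K l) /\
  forall m : R, eigenvalue A (of_real K m) -> l <= m.

(* Definite description: for [A] Hermitian and [n > 0], exactly one [l]
   satisfies the predicate; the default [0] is used only when there is none.
   The same convention is used for [invsqrtmx] and [argmin] below. *)
Definition lambda_min n (A : 'M[K]_n) : R :=
  xget 0 [set l | smallest_eigenvalue A l].

Definition is_invsqrtmx n (M P : 'M[K]_n) : Prop :=
  exists (U : 'M[K]_n) (d : 'rV[R]_n),
    [/\ U *m adjmx U = 1%:M,
        forall i, 0 < d 0 i,
        M = U *m diag_mx (map_mx (of_real K) d) *m adjmx U &
        P = U *m diag_mx (map_mx (fun t => of_real K (Num.sqrt t)^-1) d)
              *m adjmx U].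

Definition invsqrtmx n (M : 'M[K]_n) : 'M[K]_n :=
  xget 0 [set P | is_invsqrtmx M P].

Definition argmin n (T : set 'cV[K]_n) (f : 'cV[K]_n -> R) : 'cV[K]_n :=
  xget 0 [set x | T x /\ forall y, T y -> f x <= f y].

Definition affine_subspace n (T : set 'cV[K]_n) (p : nat) : Prop :=
  exists (x0 : 'cV[K]_n) (W : {vspace 'cV[K]_n}),
    \dim W = p /\ T = [set x | x - x0 \in W].

Definition parallel_subspace n (S : {vspace 'cV[K]_n}) (T : set 'cV[K]_n) :
    Prop :=
  forall z, z \in S <-> exists x y, [/\ T x, T y & z = x - y].

Definition mxim m n (M : 'M[K]_(m, n)) : {vspace 'cV[K]_m} :=
  limg (linfun (mulmx M : 'cV[K]_n -> 'cV[K]_m)).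

Definition mximg n (A : 'M[K]_n) (S : {vspace 'cV[K]_n}) : {vspace 'cV[K]_n} :=
  (linfun (mulmx A : 'cV[K]_n -> 'cV[K]_n) @: S)%VS.

Definition xmin n (A : 'M[K]_n) (T : set 'cV[K]_n) (b : 'cV[K]_n) (omega : R) :
    'cV[K]_n :=
  argmin T (fun x =>
    norm2 (invsqrtmx (A + (of_real K omega)%:M) *m (A *m x - b))).

Definition adapted_basis n p q (A : 'M[K]_n) (S : {vspace 'cV[K]_n})
    (V : 'M[K]_(n, p)) (V' : 'M[K]_(n, q)) : Prop :=
  [/\ adjmx (row_mx V V') *m row_mx V V' = 1%:M,
      mxim V = S &
      mxim (row_mx V V') = (S + mximg A S)%VS].

Section Blocks.
Variables (n p q : nat) (A : 'M[K]_n) (V : 'M[K]_(n, p)) (V' : 'M[K]_(n, q)).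

Definition Tmx : 'M[K]_p := adjmx V *m A *m V.
Definition Bmx : 'M[K]_(q, p) := adjmx V' *m A *m V.
Definition Hmx : 'M[K]_(p + q, p) := adjmx (row_mx Tmx (adjmx Bmx)).
Definition Yspace : {vspace 'cV[K]_n} :=
  mxim (V *m invmx (adjmx Hmx *m Hmx) *m adjmx Bmx).

End Blocks.

End Defs.

(* Main.v *)
Require Import Defs.
From HB Require Import structures.
From mathcomp Require Import all_boot all_order all_algebra.
From mathcomp Require Import sesquilinear spectral.
From mathcomp Require Import boolp classical_sets reals.
From mathcomp Require Import complex ring.

Set Implicit Arguments.
Unset Strict Implicit.
Unset Printing Implicit Defensive.

Import Order.TTheory GRing.Theory Num.Theory.

Local Open Scope ring_scope.

(* Write M = A + omega I and r = M^-1 (A x - b) for x = x_{b,omega}; the normal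
   equations say that r is orthogonal to A S.  For a second shift mu, with y
   and t in place of x and r, A (x - y) = (A + omega) r - (A + mu) t.  If u and
   A u both lie in S, pairing this with A u kills every term on the right, as
   <A u, A r> = <A (A u), r>; hence x - y is orthogonal to A (A u).  So x - y
   lies in the orthogonal complement, within S, of A (S cap A S), a space which
   does not involve b.
   No nonzero vector of A (S cap A S) is orthogonal to S, since
   <A (A u), u> = |A u|^2, so that complement has dimension
   dim S - dim (S cap A S) = q.  The column space of
   V (H^* H)^-1 B^* is contained in it, because H^* H = V^* A^2 V and B c = 0
   when A V c is in S, and has the same dimension. *)

(** * Spectral theorem for Hermitian and for real symmetric matrices *)

(** A Hermitian matrix is normal, hence unitarily diagonalisable, and its spectral diagonal is real,
    so [d] is obtained by taking real parts. The library's unitary factor [P] satisfies A = P^-1 D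
    P, so [U] is the adjoint of [P]. *)
Lemma complex_spectral (R : realType) n (A : 'M[R[i]]_n) :
  (map_mx conjc A)^T = A ->
  exists (U : 'M[R[i]]_n) (d : 'rV[R]_n),
    U *m (map_mx conjc U)^T = 1%:M /\
    A = U *m diag_mx (map_mx (real_complex R) d) *m (map_mx conjc U)^T.
Proof.
move=> hA.
have hherm : A \is hermsymmx.
  by apply/is_hermitianmxP; rewrite expr0 scale1r -map_trmx.
have hreal := hermitian_spectral_diag_real hherm.
have /hermitian_normalmx/orthomx_spectralP := hherm.
rewrite invmx_unitary ?spectral_unitarymx // -map_trmx.
set P := spectralmx A; set s := spectral_diag A => eqA.
have /unitarymxP : P \is unitarymx by exact: spectral_unitarymx.
rewrite -map_trmx => PP.
exists (map_mx conjc P)^T, (map_mx (@complex.Re R) s).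
have cK : (map_mx conjc (map_mx conjc P)^T)^T = P.
  by apply/matrixP=> i j; rewrite !mxE conjcK.
rewrite cK; split; first exact: mulmx1C.
rewrite {1}eqA; congr (_ *m diag_mx _ *m _).
apply/matrixP=> i j; rewrite !mxE.
by apply/esym/RRe_real; move/mxOverP: hreal => /(_ i j).
Qed.

(** Over the complex numbers [A] diagonalises with a real diagonal. Any entry of it is a root of the
    characteristic polynomial, and being a root descends along the embedding of the reals. *)
Lemma symmetric_eigenvalue (R : realType) n (A : 'M[R]_n.+1) :
  A^T = A -> exists l, eigenvalue A l.
Proof.
move=> hA; pose C := map_mx (real_complex R) A.
have hC : (map_mx conjc C)^T = C.
  by apply/matrixP=> i j; rewrite !mxE conjc_real -[in RHS]hA mxE.
have [U [d [UU eqC]]] := complex_spectral hC.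
exists (d 0 0).
rewrite eigenvalue_root_char -(fmorph_root (real_complex R)) map_char_poly.
rewrite -eigenvalue_root_char; apply/eigenvalueP.
have U'U := mulmx1C UU.
exists (row 0 (map_mx conjc U)^T).
  rewrite -row_mul -/C {1}eqC !mulmxA U'U mul1mx row_mul row_diag_mx mxE.
  by rewrite -scalemxAl -rowE.
apply/eqP=> h; have := congr1 (mulmx^~ U) h.
rewrite -row_mul U'U mul0mx => /matrixP/(_ 0 0); rewrite !mxE eqxx.
by move/eqP; rewrite oner_eq0.
Qed.

Lemma rv_sqr_eq0 (R : realDomainType) n (w : 'rV[R]_n) :
  (w *m w^T) 0 0 = 0 -> w = 0.
Proof.
rewrite mxE => /eqP; rewrite psumr_eq0 => [/allP h|i _]; last first.
  by rewrite mxE -expr2 sqr_ge0.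
apply/rowP=> i; rewrite mxE; have := h i (mem_index_enum _).
by rewrite mxE -expr2 sqrf_eq0 => /eqP.
Qed.

(** The reflection in the hyperplane orthogonal to [a - b] exchanges the unit vectors [a] and [b];
    the identity serves when they coincide. *)
Lemma householder (R : realFieldType) n (a b : 'rV[R]_n) :
  a *m a^T = 1%:M -> b *m b^T = 1%:M ->
  exists U : 'M[R]_n, U *m U^T = 1%:M /\ a *m U = b.
Proof.
move=> aa bb; pose w := a - b.
have [w0|wN0] := eqVneq w 0.
  by exists 1%:M; rewrite trmx1 !mulmx1; split=> //; apply/subr0_eq.
pose c := (a *m b^T) 0 0.
have abE : a *m b^T = c%:M by rewrite [LHS]mx11_scalar.
have baE : b *m a^T = c%:M.
  by rewrite -[LHS]trmxK trmx_mul trmxK abE tr_scalar_mx.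
have ww : w *m w^T = (2 - 2 * c)%:M.
  rewrite linearB mulmxBl !mulmxBr aa bb abE baE -!raddfB /=; congr _%:M.
  ring.
have cN : 2 - 2 * c != 0.
  apply: contraNneq wN0 => h; apply/eqP/rv_sqr_eq0.
  by rewrite ww h mxE.
have aw : a *m w^T = (1 - c)%:M by rewrite linearB mulmxBr aa abE raddfB.
(* This is 2 / |w|^2, the coefficient that makes 1 - t w^T w a reflection. *)
pose t := 2 / (2 - 2 * c).
pose M := w^T *m w.
have MM : M *m M = (2 - 2 * c) *: M.
  by rewrite /M mulmxA -(mulmxA _ w) ww mul_mx_scalar -scalemxAl.
have UT : (1%:M - t *: M)^T = 1%:M - t *: M.
  by rewrite linearB linearZ /= tr_scalar_mx trmx_mul trmxK.
exists (1%:M - t *: M); split.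
  rewrite UT mulmxBl mul1mx mulmxBr mulmx1 -!scalemxAr -!scalemxAl MM !scalerA.
  rewrite (_ : t * t * (2 - 2 * c) = t + t); last by rewrite /t; field.
  by rewrite scalerDl opprB addrK subrK.
rewrite mulmxBr mulmx1 -scalemxAr mulmxA aw mul_scalar_mx scalerA.
have -> : t * (1 - c) = 1.
  by rewrite /t mulrAC mulrBr mulr1 divff.
by rewrite scale1r /w opprB addrC subrK.
Qed.

(** Induction on the size: an orthogonal change of basis sends the first basis vector to a unit
    eigenvector, which splits off a 1 by 1 block. *)
Lemma real_spectral (R : realType) n (A : 'M[R]_n) :
  A^T = A ->
  exists (U : 'M[R]_n) (d : 'rV[R]_n),
    U *m U^T = 1%:M /\ A = U *m diag_mx d *m U^T.
Proof.
elim: n A => [|n IH] A hA.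
  by exists 1%:M, 0; split; apply/matrixP=> -[].
have [l /eigenvalueP[v0 v0A v0N0]] := symmetric_eigenvalue hA.
pose r := Num.sqrt ((v0 *m v0^T) 0 0).
have vv_ge0 : 0 <= (v0 *m v0^T) 0 0.
  by rewrite mxE sumr_ge0 // => i _; rewrite mxE -expr2 sqr_ge0.
have rN0 : r != 0.
  rewrite sqrtr_eq0 -ltNge lt_neqAle vv_ge0 andbT eq_sym.
  by apply: contraNneq v0N0 => /rv_sqr_eq0 ->.
pose v := r^-1 *: v0.
have vA : v *m A = l *: v by rewrite -scalemxAl v0A !scalerA mulrC.
have vv : v *m v^T = 1%:M.
  rewrite linearZ -scalemxAl -scalemxAr scalerA [_ *m _]mx11_scalar.
  rewrite scale_scalar_mx -[_ 0 0]sqr_sqrtr // -/r; congr _%:M.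
  by rewrite -invfM mulVf // mulf_neq0.
pose e : 'rV[R]_(1 + n) := row_mx 1%:M 0.
have ee : e *m e^T = 1%:M.
  by rewrite tr_row_mx mul_row_col trmx1 trmx0 mulmx1 mulmx0 addr0.
have [U [UU eU]] := householder ee vv.
have U'U := mulmx1C UU.
pose A' : 'M[R]_(1 + n) := U *m A *m U^T.
have hA' : A'^T = A' by rewrite /A' !trmx_mul trmxK hA mulmxA.
have eA' : e *m A' = l *: e.
  by rewrite /A' !mulmxA eU vA -eU -!scalemxAl -mulmxA UU mulmx1.
(* [e] is a left eigenvector of [A'], so the first row of [A'] is l times [e]; by symmetry the first
   column vanishes below the corner as well. *)
have usub : usubmx A' = row_mx l%:M 0.
  have -> : usubmx A' = e *m A'.
    by rewrite -[A' in RHS]vsubmxK mul_row_col mul1mx mul0mx addr0.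
  by rewrite eA' scale_row_mx scaler0 scalemx1.
pose B := drsubmx A'.
have A'E : A' = block_mx l%:M 0 0 B.
  rewrite -[LHS]submxK -/B; congr block_mx.
  - by rewrite /ulsubmx usub row_mxKl.
  - by rewrite /ursubmx usub row_mxKr.
  - by rewrite -hA' -trmx_ursub /ursubmx usub row_mxKr trmx0.
have hB : B^T = B by rewrite /B trmx_drsub hA'.
have [W [d [WW BE]]] := IH B hB.
pose Z : 'M[R]_(1 + n) := block_mx 1%:M 0 0 W.
have ZZ : Z *m Z^T = 1%:M.
  rewrite /Z tr_block_mx mulmx_block !trmx0 !mulmx0 !mul0mx trmx1 mulmx1 WW.
  by rewrite !addr0 !add0r -scalar_mx_block.
pose D : 'rV[R]_(1 + n) := row_mx l%:M d.
have A'D : A' = Z *m diag_mx D *m Z^T.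
  rewrite A'E diag_mx_row /Z tr_block_mx !mulmx_block.
  rewrite !trmx0 !mulmx0 !mul0mx trmx1 mulmx1 mul1mx !addr0 !add0r -BE.
  congr block_mx; rewrite ?mul0mx //; apply/matrixP=> i j.
  by rewrite !ord1 !mxE.
exists (U^T *m Z), D; split.
  by rewrite trmx_mul trmxK mulmxA -(mulmxA _ Z) ZZ mulmx1.
rewrite trmx_mul trmxK !mulmxA -(mulmxA _ Z) -(mulmxA _ (Z *m _)) -A'D /A'.
by rewrite !mulmxA U'U mul1mx -mulmxA U'U mulmx1.
Qed.

(** * Column spaces, images and bases of subspaces in matrix form *)

Section VspaceMatrix.
Variable F : fieldType.

Lemma mxim_memP m n (M : 'M[F]_(m, n)) v :
  reflect (exists c : 'cV_n, v = M *m c)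
          (v \in limg (linfun (mulmx M : 'cV[F]_n -> 'cV[F]_m))).
Proof.
apply: (iffP memv_imgP) => [[c _ ->]|[c ->]]; exists c; rewrite ?lfunE //.
by rewrite memvf.
Qed.

Lemma mximg_memP n (A : 'M[F]_n) (S : {vspace 'cV[F]_n}) v :
  reflect (exists2 s, s \in S & v = A *m s)
          (v \in (linfun (mulmx A : 'cV[F]_n -> 'cV[F]_n) @: S)%VS).
Proof. by apply: (iffP memv_imgP) => -[s sS ->]; exists s; rewrite ?lfunE. Qed.

Lemma dim_limg_mulmx m n (M : 'M[F]_(m, n)) (S : {vspace 'cV[F]_n}) :
  (forall c : 'cV_n, M *m c = 0 -> c = 0) ->
  \dim (linfun (mulmx M : 'cV[F]_n -> 'cV[F]_m) @: S) = \dim S.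
Proof.
move=> inj; apply: limg_dim_eq; apply/eqP; rewrite -subv0; apply/subvP=> c.
by rewrite memv_cap memv_ker lfunE => /andP[_ /eqP/inj ->]; apply: mem0v.
Qed.

Lemma inj_unitmx n (M : 'M[F]_n) :
  (forall c : 'cV_n, M *m c = 0 -> c = 0) -> M \in unitmx.
Proof.
move=> inj; rewrite -unitmx_tr -row_free_unit; apply: inj_row_free => v vM.
by rewrite -[v]trmxK [v^T]inj ?trmx0 // -[M]trmxK -trmx_mul vM trmx0.
Qed.

Lemma unitmx_inj n (M : 'M[F]_n) (c : 'cV_n) :
  M \in unitmx -> M *m c = 0 -> c = 0.
Proof. by move=> uM Mc; rewrite -(mulKmx uM c) Mc mulmx0. Qed.

Lemma vspace_basis_mx n (S : {vspace 'cV[F]_n}) :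
  exists C : 'M[F]_(n, \dim S),
    (forall v, v \in S <-> exists c, v = C *m c) /\
    (forall c : 'cV_(\dim S), C *m c = 0 -> c = 0).
Proof.
pose C : 'M[F]_(n, \dim S) := \matrix_(i, j) (vbasis S)`_j i 0.
have CE c : C *m c = \sum_j c j 0 *: (vbasis S)`_j.
  apply/colP=> i; rewrite mxE summxE; apply: eq_bigr => j _.
  by rewrite !mxE mulrC.
exists C; split=> [v|c].
  split=> [vS|[c ->]].
    exists (\col_j coord (vbasis S) j v).
    by rewrite CE {1}(coord_vbasis vS); apply: eq_bigr => j _; rewrite mxE.
  rewrite CE; apply: memv_suml => j _; apply/memvZ/vbasis_mem/mem_nth.
  by rewrite size_tuple.
rewrite CE; have /freeP h := basis_free (vbasisP S).
move=> /h {}h.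
by apply/colP=> j; rewrite h mxE.
Qed.

End VspaceMatrix.

(** * Laws shared by the two scalar fields *)

(** The interface through which the real and the complex case receive one common proof. *)
Record scalar_laws (R : realType) (K : scalars R) : Prop := ScalarLaws {
  conj_invol : involutive (conj K);
  conj_of_real : forall t, conj K (of_real K t) = of_real K t;
  mul_conj : forall z : K, z * conj K z = of_real K (modulus z ^+ 2);
  spectral_thm : forall n (A : 'M[K]_n), adjmx A = A ->
    exists (U : 'M[K]_n) (d : 'rV[R]_n), U *m adjmx U = 1%:M /\
      A = U *m diag_mx (map_mx (of_real K) d) *m adjmx U }.

Lemma real_scalar_laws (R : realType) : scalar_laws (real_scalars R).
Proof.
have cE m n (M : 'M[real_scalars R]_(m, n)) : adjmx M = M^T.
  by apply/matrixP=> i j; rewrite !mxE.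
split=> [z|t|z|n A] //=; first by rewrite -normrX ger0_norm ?sqr_ge0 // expr2.
rewrite cE => /(@real_spectral R)[U [d [UU AE]]]; exists U, d.
rewrite !cE; split=> //; rewrite [LHS]AE; congr (_ *m diag_mx _ *m _).
by apply/matrixP=> i j; rewrite !mxE.
Qed.

Lemma complex_scalar_laws (R : realType) : scalar_laws (complex_scalars R).
Proof.
split=> [z|t|z|n A] /=; first exact: conjcK.
- exact: conjc_real.
- by rewrite -sqr_normc rmorphXn; case: z.
exact: (@complex_spectral R).
Qed.

(** * Adjoints, norms and Gram matrices *)

Section Laws.
Variables (R : realType) (K : scalars R).
Hypothesis KL : scalar_laws K.

Lemma adjmxK m n (M : 'M[K]_(m, n)) : adjmx (adjmx M) = M.
Proof. by apply/matrixP=> i j; rewrite !mxE (conj_invol KL). Qed.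

Lemma adjmxM m n p (M : 'M[K]_(m, n)) (N : 'M[K]_(n, p)) :
  adjmx (M *m N) = adjmx N *m adjmx M.
Proof. by rewrite /adjmx map_mxM trmx_mul. Qed.

Lemma adjmxD m n (M N : 'M[K]_(m, n)) : adjmx (M + N) = adjmx M + adjmx N.
Proof. by rewrite /adjmx map_mxD linearD. Qed.

Lemma adjmx0 m n : adjmx (0 : 'M[K]_(m, n)) = 0.
Proof. by rewrite /adjmx map_mx0 trmx0. Qed.

Lemma adjmx_row m n1 n2 (M : 'M[K]_(m, n1)) (N : 'M[K]_(m, n2)) :
  adjmx (row_mx M N) = col_mx (adjmx M) (adjmx N).
Proof. by rewrite /adjmx map_row_mx tr_row_mx. Qed.

Lemma adjmx_diag n (d : 'rV[R]_n) :
  adjmx (diag_mx (map_mx (of_real K) d)) = diag_mx (map_mx (of_real K) d).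
Proof.
rewrite /adjmx map_diag_mx tr_diag_mx; congr diag_mx; apply/rowP=> i.
by rewrite !mxE (conj_of_real KL).
Qed.

Lemma norm2_sqr n (v : 'cV[K]_n) :
  (adjmx v *m v) 0 0 = of_real K (norm2 v ^+ 2).
Proof.
rewrite sqr_sqrtr ?sumr_ge0 // => [|i _]; last exact: sqr_ge0.
rewrite mxE rmorph_sum; apply: eq_bigr => i _.
by rewrite !mxE mulrC (mul_conj KL).
Qed.

Lemma adjmx_mul_eq0 n (v : 'cV[K]_n) : adjmx v *m v = 0 -> v = 0.
Proof.
move=> h; have := norm2_sqr v; rewrite h mxE => /esym/eqP.
rewrite fmorph_eq0 sqr_sqrtr ?sumr_ge0 // => [|i _]; last exact: sqr_ge0.
rewrite psumr_eq0 => [/allP vi0|i _]; last exact: sqr_ge0.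
apply/colP=> i; rewrite mxE; have /eqP m0 := vi0 i (mem_index_enum _).
have /eqP := mul_conj KL (v i 0).
by rewrite m0 rmorph0 mulf_eq0 fmorph_eq0 orbb => /eqP.
Qed.

Lemma norm2_pythagoras n (u v : 'cV[K]_n) : adjmx v *m u = 0 ->
  norm2 (u + v) ^+ 2 = norm2 u ^+ 2 + norm2 v ^+ 2.
Proof.
move=> vu; apply: (fmorph_inj (of_real K)); rewrite rmorphD -!norm2_sqr.
have uv : adjmx u *m v = 0 by rewrite -[LHS]adjmxK adjmxM adjmxK vu adjmx0.
by rewrite adjmxD mulmxDl !mulmxDr vu uv addr0 add0r mxE.
Qed.

Lemma gram_unitmx m n (M : 'M[K]_(m, n)) :
  (forall c : 'cV_n, M *m c = 0 -> c = 0) -> adjmx M *m M \in unitmx.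
Proof.
move=> inj; apply: inj_unitmx => c h; apply/inj/adjmx_mul_eq0.
by rewrite adjmxM -mulmxA [adjmx M *m _]mulmxA h mulmx0.
Qed.

(** * Least squares over an affine subspace *)

(** With the columns of [C] a basis of [S] and x = x0 + C g, the condition becomes a linear system
    for [g] whose matrix is the Gram matrix of Q C, invertible since Q C is injective. *)
Lemma normal_equation n (Q : 'M[K]_n) (S : {vspace 'cV[K]_n})
    (x0 c : 'cV[K]_n) : Q \in unitmx ->
  exists2 x, x - x0 \in S &
    forall s, s \in S -> adjmx (Q *m s) *m (Q *m x - c) = 0.
Proof.
move=> uQ; have [C [CP Cinj]] := vspace_basis_mx S.
pose G := adjmx (Q *m C) *m (Q *m C).
have uG : G \in unitmx.
  by apply: gram_unitmx => g; rewrite -mulmxA => /(unitmx_inj uQ)/Cinj.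
pose g := invmx G *m (adjmx (Q *m C) *m (c - Q *m x0)).
exists (x0 + C *m g) => [|s /CP[h ->]].
  by rewrite addrAC subrr add0r; apply/CP; exists g.
have -> : Q *m (x0 + C *m g) - c = Q *m C *m g - (c - Q *m x0).
  by rewrite mulmxDr mulmxA opprB addrCA addrA.
rewrite mulmxA adjmxM -mulmxA mulmxBr mulmxA -/G mulKVmx //.
by rewrite subrr mulmx0.
Qed.

(** Let [z] solve the normal equations. By Pythagoras the squared objective at y exceeds that at [z]
    by |P A (y - z)|^2, so [z] is the only minimizer and is the point that [argmin] selects. *)
Lemma argmin_normal_equation n (P A : 'M[K]_n) (S : {vspace 'cV[K]_n})
    (x0 b : 'cV[K]_n) (T : set 'cV[K]_n) :
  P \in unitmx -> A \in unitmx -> T = [set x | x - x0 \in S]%classic ->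
  let x := argmin T (fun x => norm2 (P *m (A *m x - b))) in
  x - x0 \in S /\
  forall s, s \in S -> adjmx (A *m s) *m (adjmx P *m P *m (A *m x - b)) = 0.
Proof.
move=> uP uA TE.
have uQ : P *m A \in unitmx by rewrite unitmx_mul uP.
have [z zS zn] := normal_equation S x0 (P *m b) uQ.
have QE x : P *m (A *m x - b) = P *m A *m x - P *m b by rewrite mulmxBr mulmxA.
have pyth y : y - x0 \in S -> norm2 (P *m (A *m y - b)) ^+ 2 =
    norm2 (P *m (A *m z - b)) ^+ 2 + norm2 (P *m A *m (y - z)) ^+ 2.
  move=> yS; have := memvB yS zS; rewrite opprB addrA subrK => yzS.
  rewrite -norm2_pythagoras; last by rewrite QE zn.
  by rewrite !QE mulmxBr [in RHS]addrC addrA subrK.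
pose isargmin := [set x | T x /\ forall y, T y ->
  norm2 (P *m (A *m x - b)) <= norm2 (P *m (A *m y - b))]%classic.
have norm_ge0 (v : 'cV[K]_n) : norm2 v \in Num.nneg by exact: sqrtr_ge0.
have zmin : isargmin z.
  split; first by rewrite TE.
  move=> y; rewrite TE => /= yS.
  by rewrite -ler_sqr // (pyth y) // lerDl sqr_ge0.
have minz x : isargmin x -> x = z.
  case; rewrite {1}TE /= => xS /(_ z); rewrite {1}TE => /(_ zS).
  rewrite -ler_sqr // (pyth x) // gerDl => h.
  have /eqP h0 : norm2 (P *m A *m (x - z)) ^+ 2 == 0.
    by rewrite eq_le h sqr_ge0.
  have : P *m A *m (x - z) = 0.
    apply: adjmx_mul_eq0; rewrite [LHS]mx11_scalar norm2_sqr h0 rmorph0.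
    by rewrite raddf0.
  by move=> /(unitmx_inj uQ)/subr0_eq.
move=> x; have {x}-> : x = z.
  by apply: minz; apply: (@xgetPex _ _ isargmin); exists z.
split=> // s sS; rewrite -(zn _ sS) -QE.
by rewrite -mulmxA adjmxM !adjmxM -!mulmxA.
Qed.

(** * The inverse square root of the shifted matrix *)

(** [P] is self-adjoint and its square inverts [M]. The product is written [adjmx P *m P] because
    this is the weight that occurs in the normal equations. *)
Lemma invsqrtmxP n (M P : 'M[K]_n) :
  is_invsqrtmx M P -> adjmx P *m P *m M = 1%:M.
Proof.
case=> U [d [UU d0 -> ->]]; have U'U := mulmx1C UU.
pose e : 'rV[R]_n := map_mx (fun t => (Num.sqrt t)^-1) d.
have -> : map_mx (fun t => of_real K (Num.sqrt t)^-1) d = map_mx (of_real K) e.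
  by apply/rowP=> i; rewrite !mxE.
set E := diag_mx (map_mx _ e).
set D := diag_mx _.
have EED : E *m E *m D = 1%:M.
  rewrite /E /D !mulmx_diag -diag_const_mx; congr diag_mx; apply/rowP=> i.
  rewrite !mxE -!rmorphM -[d in (_ * d)]sqr_sqrtr ?ltW // -expr2 -exprMn.
  by rewrite mulVf ?expr1n ?rmorph1 // sqrtr_eq0 -ltNge.
rewrite !adjmxM adjmxK adjmx_diag -/E !mulmxA.
rewrite -(mulmxA _ (adjmx U) U) U'U mulmx1.
rewrite -(mulmxA _ (adjmx U) U) U'U mulmx1.
by rewrite -(mulmxA U) -(mulmxA U) EED mulmx1.
Qed.

(** The real eigenvalues of [A] are exactly the entries of [d], so their minimum satisfies
    [smallest_eigenvalue] and [lambda_min] is not the default value. *)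
Lemma lambda_min_le n (A : 'M[K]_n) (U : 'M[K]_n) (d : 'rV[R]_n) i :
  U *m adjmx U = 1%:M -> A = U *m diag_mx (map_mx (of_real K) d) *m adjmx U ->
  lambda_min A <= d 0 i.
Proof.
move=> UU AE; have U'U := mulmx1C UU.
have eigd j : eigenvalue A (of_real K (d 0 j)).
  apply/eigenvalueP; exists (row j (adjmx U)).
    rewrite -row_mul AE !mulmxA U'U mul1mx row_mul row_diag_mx mxE.
    by rewrite -scalemxAl -rowE.
  apply/eqP=> h; have := congr1 (mulmx^~ U) h.
  rewrite -row_mul U'U mul0mx => /matrixP/(_ 0 j); rewrite !mxE eqxx.
  by move/eqP; rewrite oner_eq0.
have deig m : eigenvalue A (of_real K m) -> exists j, m = d 0 j.
  case/eigenvalueP=> v vA vN0; pose w := v *m U.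
  have wD : w *m diag_mx (map_mx (of_real K) d) = of_real K m *: w.
    have := congr1 (mulmx^~ U) vA.
    by rewrite AE /w -!mulmxA U'U mulmx1 scalemxAl.
  have /rV0Pn[j wj] : w != 0.
    apply: contraNneq vN0 => w0.
    by rewrite -[v]mulmx1 -UU mulmxA -/w w0 mul0mx.
  exists j; apply: (fmorph_inj (of_real K)); apply: (mulIf wj).
  by have /rowP/(_ j) := wD; rewrite mul_mx_diag !mxE => <-; rewrite mulrC.
(* The given index [i] shows that the minimum ranges over a nonempty set. *)
have [j _ jmin] := @Order.TotalTheory.arg_minP _ _ _ i xpredT (d 0) isT.
have : smallest_eigenvalue A (lambda_min A).
  apply: (@xgetPex _ _ [set l | smallest_eigenvalue A l]%classic).
  exists (d 0 j); split=> // m /deig[k ->]; exact: jmin.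
by case=> _; apply.
Qed.

(** The shift adds [omega] to every eigenvalue and makes them all positive, so an inverse square
    root exists and [invsqrtmx] returns one. *)
Lemma invsqrtmx_shift n (A : 'M[K]_n) omega : adjmx A = A ->
  - lambda_min A < omega ->
  let M := A + (of_real K omega)%:M in let P := invsqrtmx M in
  adjmx P *m P *m M = 1%:M.
Proof.
move=> hA lo M P; apply: invsqrtmxP.
apply: (@xgetPex _ _ [set P | is_invsqrtmx M P]%classic).
have [U [d [UU AE]]] := spectral_thm KL hA.
pose d' : 'rV[R]_n := map_mx (+%R omega) d.
exists (U *m diag_mx (map_mx (fun t => of_real K (Num.sqrt t)^-1) d') *m
        adjmx U), U, d'; split=> // [i|].
  rewrite mxE -ltrBlDr sub0r ltrNl; apply: lt_le_trans (lambda_min_le i UU AE).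
  by rewrite ltrNl.
rewrite /M [in LHS]AE.
have -> : diag_mx (map_mx (of_real K) (map_mx (+%R omega) d)) =
    diag_mx (map_mx (of_real K) d) + (of_real K omega)%:M.
  rewrite -diag_const_mx -raddfD; congr diag_mx; apply/rowP=> i.
  by rewrite !mxE rmorphD addrC.
by rewrite mulmxDr mulmxDl mul_mx_scalar -scalemxAl UU scalemx1.
Qed.

(** * The subspace containing all differences of minimizers *)

Lemma invariant_orthogonal_subspace n (A : 'M[K]_n) (S : {vspace 'cV[K]_n}) :
  A \in unitmx -> adjmx A = A ->
  exists Y : {vspace 'cV[K]_n},
    \dim Y = (\dim (S + mximg A S)%VS - \dim S)%N /\
    forall d, d \in Y <->
      d \in S /\
      forall u, u \in S -> A *m u \in S -> adjmx (A *m (A *m u)) *m d = 0.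
Proof.
move=> uA hA; have Ainj (c : 'cV_n) := @unitmx_inj _ _ A c uA.
pose W := mximg A (S :&: mximg A S)%VS.
have WP w : reflect (exists u, [/\ u \in S, A *m u \in S & w = A *m (A *m u)])
                    (w \in W).
  apply: (iffP (mximg_memP _ _ _)) => [[s]|[u [uS AuS ->]]].
    by rewrite memv_cap => /andP[sS /mximg_memP[u uS es]] ->; exists u; split;
      rewrite // -es.
  exists (A *m u) => //; rewrite memv_cap AuS; apply/mximg_memP; by exists u.
have [C [CP Cinj]] := vspace_basis_mx W.
have [V [VP _]] := vspace_basis_mx S.
(* A vanishing combination of rows gives a vector A (A u) of [W] orthogonal to [S]; pairing it with
   u, which is in [S], yields |A u|^2 = 0. Full row rank then makes [adjmx C] map [S] onto the whole
   target. *)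
have freeCV : row_free (adjmx C *m V).
  apply: inj_row_free => v vCV; rewrite -[v]adjmxK.
  suff -> : adjmx v = 0 by rewrite adjmx0.
  apply: Cinj; have /WP[u [uS AuS Cv]] : C *m adjmx v \in W.
    by apply/CP; exists (adjmx v).
  have [h uE] := (VP u).1 uS.
  have Au0 : A *m u = 0.
    apply: adjmx_mul_eq0; rewrite -[X in _ *m (X *m _)]hA mulmxA -adjmxM.
    by rewrite -Cv adjmxM adjmxK uE mulmxA -(mulmxA v) vCV mul0mx.
  by rewrite Cv Au0 mulmx0.
pose f := linfun (mulmx (adjmx C) : 'cV[K]_n -> 'cV[K]_(\dim W)).
have fS : (f @: S)%VS = fullv.
  apply/eqP; rewrite eqEsubv subvf; apply/subvP=> y _.
  apply/memv_imgP; exists (V *m (pinvmx (adjmx C *m V) *m y)).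
    by apply/VP; eexists.
  by rewrite lfunE /= [RHS]mulmxA [RHS]mulmxA mulmxVp // mul1mx.
exists (S :&: lker f)%VS; split; last first.
  move=> d; rewrite memv_cap memv_ker lfunE; split=> [/andP[dS /eqP Cd]|].
    split=> // u uS AuS.
    have /CP[h ->] : A *m (A *m u) \in W by apply/WP; exists u.
    by rewrite adjmxM -mulmxA Cd mulmx0.
  case=> -> orth; apply/eqP/adjmx_mul_eq0.
  have /WP[u [uS AuS CE]] : C *m (adjmx C *m d) \in W by apply/CP; eexists.
  by rewrite /= mulmxA -adjmxM CE; apply: orth.
have dimA U : \dim (mximg A U) = \dim U by apply: dim_limg_mulmx.
(* Rank-nullity gives dim Y = dim S - dim W, and the dimension formula for S + A S gives the same
   value for its excess over dim S. *)
have := limg_ker_dim f S; rewrite fS dimvf /dim /= muln1 => dY.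
have := dimv_sum_cap S (mximg A S); rewrite dimA => dSA.
have dW : \dim W = \dim (S :&: mximg A S)%VS by exact: dimA.
by rewrite -[\dim (S + _)](addnK (\dim W)) {2}dW dSA subnAC addnK -dY addnK.
Qed.

Lemma shift_difference_orthogonal n (A : 'M[K]_n) (S : {vspace 'cV[K]_n})
    (omega mu : K) (b x y r t : 'cV[K]_n) :
  adjmx A = A ->
  (forall s, s \in S -> adjmx (A *m s) *m r = 0) ->
  (forall s, s \in S -> adjmx (A *m s) *m t = 0) ->
  (A + omega%:M) *m r = A *m x - b -> (A + mu%:M) *m t = A *m y - b ->
  forall u, u \in S -> A *m u \in S -> adjmx (A *m (A *m u)) *m (x - y) = 0.
Proof.
move=> hA rS tS rE tE u uS AuS.
have -> : adjmx (A *m (A *m u)) *m (x - y) =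
    adjmx (A *m u) *m (A *m x - b) - adjmx (A *m u) *m (A *m y - b).
  rewrite adjmxM hA -mulmxA -mulmxBr; congr (_ *m _).
  by rewrite mulmxBr opprB addrA subrK.
(* For v = r or t the first term vanishes because A u is in [S], the second because u is, whatever
   the shift z. *)
have shift (z : K) v : adjmx (A *m u) *m ((A + z%:M) *m v) =
    adjmx (A *m (A *m u)) *m v + z *: (adjmx (A *m u) *m v).
  by rewrite mulmxDl mulmxDr mul_scalar_mx -scalemxAr [in RHS]adjmxM hA mulmxA.
by rewrite -rE -tE !shift !rS ?tS // !scaler0 !addr0 subrr.
Qed.

(** * The explicit description of the subspace *)

Lemma adapted_basis_Yspace n p q (A : 'M[K]_n) (S : {vspace 'cV[K]_n})
    (V : 'M[K]_(n, p)) (V' : 'M[K]_(n, q)) :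
  A \in unitmx -> adjmx A = A -> adapted_basis A S V V' ->
  [/\ adjmx (Hmx A V V') *m Hmx A V V' \in unitmx,
      \dim (Yspace A V V') = q &
      forall d, d \in Yspace A V V' ->
        d \in S /\
        forall u, u \in S -> A *m u \in S -> adjmx (A *m (A *m u)) *m d = 0].
Proof.
move=> uA hA [NN VS NS].
set N := row_mx V V' in NN NS.
have VP v : v \in S <-> exists c, v = V *m c.
  by rewrite -VS; split=> /mxim_memP.
have NP v : v \in (S + mximg A S)%VS <-> exists c, v = N *m c.
  by rewrite -NS; split=> /mxim_memP.
move: (NN); rewrite /N adjmx_row mul_col_row scalar_mx_block.
case/eq_block_mx => V1 V0 V'0 V'1.
have Vinj (c : 'cV_p) : V *m c = 0 -> c = 0.
  by move=> Vc; rewrite -[c]mul1mx -V1 -mulmxA Vc mulmx0.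
have AVS c : A *m (V *m c) \in (S + mximg A S)%VS.
  apply/(subvP (addvSr _ _))/mximg_memP; exists (V *m c) => //.
  by apply/VP; exists c.
(* N N^* is the orthogonal projection onto S + A S, which contains the columns of A V. Since H = N^*
   A V, this yields H^* H = V^* A^2 V. *)
have projAV : N *m (adjmx N *m (A *m V)) = A *m V.
  apply/trmx_inj/row_matrixP=> j; rewrite -!tr_col; congr _^T.
  rewrite !colE -!mulmxA; have /NP[h ->] := AVS (delta_mx j 0).
  by rewrite (mulmxA (adjmx N)) NN mul1mx.
have HE : Hmx A V V' = adjmx N *m (A *m V).
  rewrite /Hmx /Tmx /Bmx adjmx_row adjmxK /N adjmx_row mul_col_mx.
  by rewrite !adjmxM adjmxK hA !mulmxA.
pose G := adjmx (A *m V) *m (A *m V).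
have GE : adjmx (Hmx A V V') *m Hmx A V V' = G.
  by rewrite HE adjmxM adjmxK -mulmxA projAV.
have uG : G \in unitmx.
  by apply: gram_unitmx => c; rewrite -mulmxA => /(unitmx_inj uA)/Vinj.
split; first by rewrite GE.
  rewrite /Yspace /mxim dim_limg_mulmx ?dimvf /dim /= ?muln1 // => z.
  rewrite GE -!mulmxA => /Vinj/(unitmx_inj _) Bz.
  have {}Bz : adjmx (Bmx A V V') *m z = 0 by apply: Bz; rewrite unitmx_inv.
  (* Injectivity of B^*: write V' z = s + A V c' with s in [S]. Applying V'^* removes s and gives z
     = B c', so |z|^2 = c'^* B^* z = 0. *)
  have : V' *m z \in (S + mximg A S)%VS.
    apply/NP; exists (col_mx 0 z).
    by rewrite /N mul_row_col mulmx0 add0r.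
  case/memv_addP=> s /VP[c ->] [_ /mximg_memP[_ /VP[c' ->] ->] V'z].
  apply: adjmx_mul_eq0.
  have zE : z = Bmx A V V' *m c'.
    rewrite -[LHS]mul1mx -V'1 -mulmxA V'z mulmxDr mulmxA V'0 mul0mx add0r.
    by rewrite /Bmx !mulmxA.
  by rewrite {1}zE adjmxM -mulmxA Bz mulmx0.
move=> d /mxim_memP[z ->]; split.
  by apply/VP; eexists; rewrite -!mulmxA.
move=> u /VP[c ->] AuS; rewrite GE.
have Bc : Bmx A V V' *m c = 0.
  have /VP[h AVc] := AuS.
  by rewrite /Bmx -!mulmxA AVc mulmxA V'0 mul0mx.
(* The factor V^* A^2 V is [G], which cancels its inverse and leaves the adjoint of B c, already
   known to be zero. *)
have -> : adjmx (A *m (A *m (V *m c))) *m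
    (V *m invmx G *m adjmx (Bmx A V V') *m z) =
    adjmx c *m (G *m (invmx G *m (adjmx (Bmx A V V') *m z))).
  by rewrite /G !adjmxM hA !mulmxA.
by rewrite mulKVmx // mulmxA -adjmxM Bc adjmx0 mul0mx.
Qed.

End Laws.

(** * Assembly of the theorem *)

Theorem theorem1p1 (R : realType) (K : scalars R)
    (hK : K = real_scalars R \/ K = complex_scalars R)
    (n p q : nat) (hp : (1 <= p <= n)%N)
    (A : 'M[K]_n) (hAunit : A \in unitmx) (hAherm : adjmx A = A)
    (T : set 'cV[K]_n) (hT : affine_subspace T p)
    (S : {vspace 'cV[K]_n}) (hS : parallel_subspace S T)
    (hq : q = (\dim (S + mximg A S)%VS - \dim S)%N) :
  let omega_min := - lambda_min A in
  let works (Y : {vspace 'cV[K]_n}) :=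
    \dim Y = q /\
    forall (b : 'cV[K]_n) (omega mu : R),
      omega_min < omega -> omega_min < mu ->
      xmin A T b omega - xmin A T b mu \in Y in
  (exists Y : {vspace 'cV[K]_n}, works Y) /\
  ((1 <= q)%N ->
    (forall (V : 'M[K]_(n, p)) (V' : 'M[K]_(n, q)),
      adapted_basis A S V V' ->
      adjmx (Hmx A V V') *m Hmx A V V' \in unitmx /\ works (Yspace A V V')) /\
    (forall (V1 V2 : 'M[K]_(n, p)) (V1' V2' : 'M[K]_(n, q)),
      adapted_basis A S V1 V1' -> adapted_basis A S V2 V2' ->
      Yspace A V1 V1' = Yspace A V2 V2')).
Proof.
have KL : scalar_laws K.
  by case: hK => ->; [apply: real_scalar_laws | apply: complex_scalar_laws].
move=> omega_min works.
have [x0 [W [_ TW]]] := hT.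
have WS : W = S.
  apply/vspaceP=> z; apply/idP/idP => [zW|/hS[x [y [+ + ->]]]].
    apply/hS; exists (x0 + z), x0; rewrite TW /= subrr mem0v.
    by split; rewrite ?[x0 + z]addrC ?addrK.
  rewrite TW /= => xW yW; have := memvB xW yW.
  by rewrite opprB addrA subrK.
rewrite {}WS in TW.
have [Y [dimY YP]] := invariant_orthogonal_subspace KL S hAunit hAherm.
have Yworks : works Y.
  split=> [|b omega mu lo lm]; first by rewrite dimY hq.
  (* The vector r is the residual A x - b multiplied by the inverse of the shifted matrix. *)
  have nrm w : omega_min < w ->
      let x := xmin A T b w in x - x0 \in S /\ exists r,
      (forall s, s \in S -> adjmx (A *m s) *m r = 0) /\
      (A + (of_real K w)%:M) *m r = A *m x - b.
    move=> lw x; have PM := invsqrtmx_shift KL hAherm lw.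
    set M := A + _ in PM *; set P := invsqrtmx M in PM.
    have uP : P \in unitmx.
      by have [+ _] := mulmx1_unit PM; rewrite unitmx_mul => /andP[].
    have [xS xn] := argmin_normal_equation KL b uP hAunit TW.
    split=> //; exists (adjmx P *m P *m (A *m x - b)); split=> //.
    by rewrite mulmxA (mulmx1C PM) mul1mx.
  have [xS [r [rS rE]]] := nrm _ lo; have [yS [t [tS tE]]] := nrm _ lm.
  apply/YP; split.
    by have := memvB xS yS; rewrite opprB addrA subrK.
  exact: shift_difference_orthogonal hAherm rS tS rE tE.
(* Inclusion in [Y] and equality of dimensions force equality with [Y], which is built without [V]
   and [V']; independence of the choice follows. *)
have Yspan V V' : adapted_basis A S V V' ->
    adjmx (@Hmx _ _ n p q A V V') *m Hmx A V V' \in unitmx /\ Yspace A V V' = Y.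
  move=> /(adapted_basis_Yspace KL hAunit hAherm)[uH dimH HY]; split=> //.
  apply/eqP; rewrite eqEdim dimH dimY -hq leqnn andbT.
  by apply/subvP=> d /HY/YP.
split; first by exists Y.
move=> _; split=> [V V' /Yspan[uH ->] //|].
by move=> V1 V2 V1' V2' /Yspan[_ ->] /Yspan[_ ->].
Qed.
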